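(* Let $f:\mathbb{R}_+^N\to\mathbb{R}_+^N$ be a monotone and positively homogeneous map having a positive eigenvector $u$ (all entries positive), $f(u)=\lambda u$ with $\lambda>0$, normalized so that $\prod_{i=1}^N u_i=1$. Suppose that $f$ is differentiable at $u$, let $\lambda=\mu_1,\mu_2,\dots,\mu_N$ be the eigenvalues of $f'(u)$ counted with multiplicities, let $$\vartheta:=\max_{2\leq i\leq N}\frac{|1+\mu_i\lambda^{-1}|}{2},$$ and suppose that $\vartheta<1$. Let $v^0\in\mathbb{R}_+^N$ be any vector with positive entries such that $\prod_{i=1}^N v^0_i=1$, and let $(v^k)_{k\geq 0}$ be the sequence defined by the projective Krasnoselskii-Mann iteration $$v^{k+1}=\left[\frac{f(v^k)}{G[f(v^k)]}\circ v^k\right]^{1/2},\qquad k\geq 0.$$ Then $$\limsup_{k\to\infty}\,(d_T(v^k,u))^{1/k}\leq\vartheta.$$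
   Context: $\mathbb{R}_+^N$ is the closed cone of vectors with nonnegative entries, with the entrywise order $\leq$. $f$ is monotone if $x\leq y\Rightarrow f(x)\leq f(y)$, and positively homogeneous (of degree one) if $f(\lambda x)=\lambda f(x)$ for all $\lambda>0$. $\circ$ denotes the entrywise product of vectors, $[\cdot]^{1/2}$ is the entrywise square root, and $G(x)=(x_1\cdots x_N)^{1/N}$ is the geometric mean of the entries of $x$. Thompson's metric on the interior of $\mathbb{R}_+^N$: $d_T(x,y)=\|\log x-\log y\|_\infty$, with $\log$ entrywise and $\|\cdot\|_\infty$ the sup-norm. The derivative $f'(u)$ is identified with an $N\times N$ matrix; it is nonnegative since $f$ is monotone, and homogeneity of $f$ gives $f'(u)u=\lambda u$, so $\lambda$ is an eigenvalue of $f'(u)$ (equal to its spectral radius). The remaining eigenvalues $\mu_2,\dots,\mu_N$ may be complex, and $\lambda$ may appear again among them if it is not simple. If $N=1$, the maximum over the empty set is taken to be $0$. *)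

(* Defs.v *)
From HB Require Import structures.
From mathcomp Require Import all_boot all_order all_algebra.
From mathcomp Require Import complex.
From mathcomp Require Import all_classical all_reals all_analysis.

Set Implicit Arguments.
Unset Strict Implicit.
Unset Printing Implicit Defensive.

Import Order.TTheory GRing.Theory Num.Theory.
Import numFieldNormedType.Exports.

Local Open Scope ring_scope.

(* Vectors are row vectors, so that the library's [jacobian] applies; it acts on
   the right, ['d f u h = h *m jacobian f u], and so is the transpose of the
   usual matrix of f'(u), with the same characteristic polynomial.

   A map on the closed cone is represented by a function on the whole space,
   all of whose properties are required on the cone only. *)

Section Cone.
Context {R : realType} {N : nat}.
Implicit Types (x y : 'rV[R]_N) (f : 'rV[R]_N -> 'rV[R]_N).

Definition le_entrywise x y : Prop := forall i, x 0 i <= y 0 i.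

Definition in_cone x : Prop := forall i, 0 <= x 0 i.

Definition positive_vec x : Prop := forall i, 0 < x 0 i.

Definition cone_map f : Prop := forall x, in_cone x -> in_cone (f x).

Definition monotone_on_cone f : Prop :=
  forall x y, in_cone x -> in_cone y ->
    le_entrywise x y -> le_entrywise (f x) (f y).

Definition homogeneous_on_cone f : Prop :=
  forall (c : R) x, 0 < c -> in_cone x -> f (c *: x) = c *: f x.

Definition geo_mean x : R := (\prod_i x 0 i) `^ (N%:R)^-1.

(* The norm on matrices is the sup-norm of the entries. *)
Definition thompson x y : R := `| map_mx (@ln R) x - map_mx (@ln R) y |.

Definition proj_KM_step f x : 'rV[R]_N :=
  \row_i Num.sqrt (f x 0 i / geo_mean (f x) * x 0 i).

End Cone.

Section Spectrum.
Context {R : realType}.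

(* [mu] lists the complex eigenvalues of the real matrix [A], each repeated
   according to its algebraic multiplicity. *)
Definition eigenvalues_of (N : nat) (A : 'M[R]_N) (mu : 'I_N -> R[i]) : Prop :=
  char_poly (map_mx (real_complex R) A) = \prod_(i < N) ('X - (mu i)%:P).

(* The terms are nonnegative, so the neutral element 0 only matters when the
   range is empty. *)
Definition vartheta (n : nat) (lambda : R) (mu : 'I_n.+1 -> R[i]) : R :=
  \big[Num.max/0]_(i < n.+1 | i != ord0)
    (ComplexField.Normc.normc (1 + mu i * (real_complex R lambda)^-1) / 2).

End Spectrum.

(* Main.v *)
Require Import Defs.
From HB Require Import structures.
From mathcomp Require Import all_boot all_order all_algebra.
From mathcomp Require Import complex.
From mathcomp Require Import all_classical all_reals all_analysis.
From mathcomp Require Import ring lra.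

Set Implicit Arguments.
Unset Strict Implicit.
Unset Printing Implicit Defensive.

Import Order.TTheory GRing.Theory Num.Theory.
Import numFieldNormedType.Exports.

Local Open Scope ring_scope.

(* In the coordinates x_i = log (v_i / u_i) the iteration becomes, up to adding
   constant vectors, the iteration of g = (id + T)/2, where T is monotone and
   commutes with the addition of constants.  Hence g is nonexpansive for the
   oscillation seminorm max x_i - min x_i, it fixes 0, and its derivative P at 0
   fixes the constant vectors.  On the quotient by them P has eigenvalues
   (1 + mu_i / lambda) / 2, i >= 2, so by Cayley-Hamilton its powers are bounded
   by C rho^k for every rho > vartheta, and some iterate of g contracts the
   oscillation near 0 by rho^m.  Cutting the segment from 0 to x at a small
   oscillation r shows that this iterate also decreases larger oscillations by a
   fixed amount, so every orbit enters the region of contraction.  Finally, on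
   vectors of zero sum the sup-norm is at most the oscillation. *)

(** * Row vectors modulo the line of constant vectors *)

Section Quotient.
Context {F : fieldType}.

Lemma char_poly_similar n (S A B : 'M[F]_n) :
  S \in unitmx -> S *m A = B *m S -> char_poly A = char_poly B.
Proof.
move=> Su SA.
have detS : \det (map_mx polyC S) != 0.
  by rewrite det_map_mx polyC_eq0 -unitfE -unitmxE.
apply: (mulfI detS); rewrite mulrC /char_poly [RHS]mulrC -!det_mulmx.
have -> : char_poly_mx B *m map_mx polyC S = map_mx polyC S *m char_poly_mx A.
  rewrite /char_poly_mx mulmxBl mulmxBr -!map_mxM -SA; congr (_ - _).
  by rewrite mul_scalar_mx mul_mx_scalar.
by rewrite !det_mulmx mulrC.
Qed.

(* Coordinates on the quotient by the line spanned by the all-ones vector. *)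
Definition quot_mx n : 'M[F]_(1 + n, n) := col_mx (const_mx (-1)) 1%:M.

(** The matrix that [A] induces on the quotient when the all-ones row is an eigenvector: lift by a
    zero first entry, apply [A], project. The lift picks out the lower rows of [A]. *)
Definition quot_end n (A : 'M[F]_(1 + n)) : 'M[F]_n := dsubmx A *m quot_mx n.

Lemma ones_quot_mx n : const_mx 1 *m quot_mx n = 0 :> 'rV_n.
Proof.
rewrite /quot_mx -[const_mx 1]hsubmxK mul_row_col mulmx1; apply/matrixP => i j.
by rewrite !mxE big_ord1 !mxE !mul1r addNr.
Qed.

Lemma quot_mxE n (h : 'rV[F]_(1 + n)) (i : 'I_n) :
  (h *m quot_mx n) 0 i = h 0 (rshift 1 i) - h 0 0.
Proof.
rewrite /quot_mx -{1}[h]hsubmxK mul_row_col mulmx1 !mxE big_ord1 !mxE mulrN1.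
by rewrite addrC; congr (_ - h _ _); apply/val_inj.
Qed.

Definition unquot_mx n : 'M[F]_(n, 1 + n) := row_mx 0 1%:M.

(** A row is its first entry times the all-ones row plus the lift of its quotient coordinates. *)
Lemma quot_unquot_mx n :
  1%:M = col_mx 1%:M 0 *m const_mx 1 + quot_mx n *m unquot_mx n.
Proof.
rewrite -[const_mx 1]hsubmxK mul_col_row !mul1mx !mul0mx mul_col_row !mulmx0.
rewrite !mul1mx mulmx1 add_block_mx !addr0 !add0r (scalar_mx_block 1 n).
congr (block_mx _ _ _ _); apply/matrixP => i j; rewrite !mxE ?subrr //.
by rewrite (ord1 i) (ord1 j).
Qed.

Lemma unquot_mulmx n (A : 'M[F]_(1 + n)) : unquot_mx n *m A = dsubmx A.
Proof. by rewrite -{1}[A]vsubmxK mul_row_col mul0mx mul1mx add0r. Qed.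

Section OnesEigenvector.
Variables (n : nat) (A : 'M[F]_(1 + n)) (lam : F).
Hypothesis onesA : const_mx 1 *m A = lam *: (const_mx 1 : 'rV_(1 + n)).

Lemma quot_endP : A *m quot_mx n = quot_mx n *m quot_end A.
Proof.
rewrite -{1}[A]mul1mx (quot_unquot_mx n) !mulmxDl -!mulmxA (mulmxA (const_mx 1)).
rewrite onesA -scalemxAl ones_quot_mx scaler0 mulmx0 add0r.
by rewrite (mulmxA (unquot_mx n)) unquot_mulmx.
Qed.

(** In the basis formed by the all-ones row and the last [n] unit rows (the rows of [S]), [A]
    becomes block lower triangular with diagonal blocks [lam] and [quot_end A]. *)
Lemma char_poly_quot : char_poly A = ('X - lam%:P) * char_poly (quot_end A).
Proof.
pose S : 'M[F]_(1 + n) := col_mx (const_mx 1) (unquot_mx n).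
pose B : 'M[F]_(1 + n) :=
  block_mx lam%:M 0 (dsubmx A *m col_mx 1%:M 0) (quot_end A).
have Su : S \in unitmx.
  rewrite /S -[const_mx 1]hsubmxK unitmxE det_ublock det1 mulr1 det_mx11 !mxE.
  exact: unitr1.
have SA : S *m A = B *m S.
  rewrite /S /B mul_block_col mul_col_mx onesA mul_scalar_mx mul0mx addr0.
  congr col_mx; rewrite unquot_mulmx -[LHS]mulmx1 (quot_unquot_mx n) mulmxDr.
  by rewrite /quot_end !mulmxA.
rewrite (char_poly_similar Su SA) /char_poly /char_poly_mx /B map_block_mx.
rewrite map_mx0 scalar_mx_block opp_block_mx add_block_mx oppr0 addr0.
by rewrite det_lblock det_mx11 !mxE.
Qed.

End OnesEigenvector.

End Quotient.

(** Cayley-Hamilton in factored form. The factor [c] allows an affine image of [B] to be treated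
    without computing its own characteristic polynomial. *)
Lemma prod_roots_char_poly (F : fieldType) n (B : 'M[F]_n) (I : finType)
    (D : pred I) (mu : I -> F) (c : F) :
  char_poly B = \prod_(i | D i) ('X - (mu i)%:P) ->
  \prod_(i | D i) (c *: (B - (mu i)%:M)) = 0.
Proof.
case: n B => [|n] B BE; first by apply/matrixP => -[].
rewrite scaler_prod (_ : \prod_(i | D i) (B - (mu i)%:M) = 0) ?scaler0//.
rewrite -(Cayley_Hamilton B) BE rmorph_prod; apply: eq_bigr => i _.
by rewrite rmorphB/= horner_mx_X horner_mx_C.
Qed.

(** * Geometric growth of matrix powers from an annihilating product *)

Section PowerGrowth.
Context {R : realType}.
Local Notation normc := ComplexField.Normc.normc.

Lemma normc_ge0 (z : R[i]) : 0 <= normc z.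
Proof. by case: z => a b /=; exact: sqrtr_ge0. Qed.

(** A first-order recurrence with geometric forcing keeps the rate [rho], since [rho] strictly
    exceeds [normc al]. The induction closes as soon as [C <= D * (rho - normc al)], which dictates
    [D]. *)
Lemma recurrence_bound (a : nat -> R[i]) (al : R[i]) (rho C : R) :
  normc al < rho ->
  (forall k, normc (a k.+1 - al * a k) <= C * rho ^+ k) ->
  exists2 D : R, 0 <= D & forall k, normc (a k) <= D * rho ^+ k.
Proof.
move=> al_rho aC; have rho0 : 0 < rho := le_lt_trans (normc_ge0 _) al_rho.
have C0 : 0 <= C.
  by have := aC 0%N; rewrite expr0 mulr1; apply: le_trans; exact: normc_ge0.
have d0 : 0 < rho - normc al by rewrite subr_gt0.
pose D := normc (a 0%N) + C / (rho - normc al).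
exists D => [|k]; first by rewrite addr_ge0 ?normc_ge0 // divr_ge0 // ltW.
elim: k => [|k IH].
  by rewrite expr0 mulr1 lerDl divr_ge0 // ltW.
have rk : 0 <= rho ^+ k by rewrite exprn_ge0 // ltW.
have -> : a k.+1 = (a k.+1 - al * a k) + al * a k by rewrite subrK.
apply: (le_trans (le_normcD _ _)); rewrite ComplexField.Normc.normcM.
apply: (@le_trans _ _ (C * rho ^+ k + normc al * (D * rho ^+ k))).
  by apply: lerD; rewrite ?aC // ler_wpM2l ?normc_ge0.
rewrite mulrA -mulrDl exprS mulrA ler_wpM2r //.
have : C <= D * (rho - normc al).
  by rewrite -ler_pdivrMr // lerDr normc_ge0.
by rewrite mulrBr; lra.
Qed.

(** Induction on the factors of the annihilating product: [W] absorbs the first factor, and the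
    bound for [W * (B - al%:M)] says that the entries of [W * B ^+ k] satisfy a recurrence of ratio
    [al] with geometric forcing. No diagonalization or Jordan form is involved. *)
Lemma power_bound n (B : 'M[R[i]]_n) (s : seq R[i]) (rho : R) :
  (forall al, al \in s -> normc al < rho) -> 0 < rho ->
  forall W : 'M[R[i]]_n, W * \prod_(al <- s) (B - al%:M) = 0 ->
  forall i j, exists2 D : R, 0 <= D &
    forall k, normc ((W * B ^+ k) i j) <= D * rho ^+ k.
Proof.
move=> s_rho rho0; elim: s s_rho => [|al s IH] s_rho W.
  rewrite big_nil mulr1 => -> i j; exists 0 => // k.
  by rewrite !mul0r mxE ComplexField.Normc.normc0.
rewrite big_cons mulrA => /IH{}IH i j.
have [|D D0 Dk] := IH _ i j.
  by move=> be bes; apply: s_rho; rewrite inE bes orbT.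
apply: (@recurrence_bound _ al _ D); first by apply: s_rho; rewrite mem_head.
move=> k; have := Dk k; congr (_ <= _); congr (normc _).
rewrite mulrBr mulrBl -mulrA -exprS !mxE; congr (_ - _).
rewrite -[W * al%:M]/(W *m al%:M) mul_mx_scalar.
by rewrite big_distrr; apply: eq_bigr => l _; rewrite mxE -mulrA.
Qed.

End PowerGrowth.

(** * Powers of the averaged matrix on the quotient *)

Section QuotientGrowth.
Context {R : realType}.
Local Notation normc := ComplexField.Normc.normc.
Local Notation toC := (real_complex R).

Lemma quot_end1 (F : fieldType) n : quot_end 1%:M = 1%:M :> 'M[F]_n.
Proof.
rewrite /quot_end (scalar_mx_block 1 n) /block_mx col_mxKd /quot_mx mul_row_col.
by rewrite mul0mx mul1mx add0r.
Qed.

Lemma quot_endD (F : fieldType) n (A B : 'M[F]_(1 + n)) :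
  quot_end (A + B) = quot_end A + quot_end B.
Proof. by rewrite /quot_end linearD mulmxDl. Qed.

Lemma quot_endZ (F : fieldType) n (a : F) (A : 'M[F]_(1 + n)) :
  quot_end (a *: A) = a *: quot_end A.
Proof. by rewrite /quot_end linearZ -scalemxAl. Qed.

Lemma map_quot_end n (A : 'M[R]_(1 + n)) :
  map_mx toC (quot_end A) = quot_end (map_mx toC A).
Proof.
rewrite /quot_end map_mxM map_dsubmx /quot_mx map_col_mx map_scalar_mx rmorph1.
by rewrite map_const_mx rmorphN1.
Qed.

Lemma normc_real (x : R) : normc (toC x) = `|x|.
Proof. by rewrite /= expr0n addr0 sqrtr_sqr. Qed.

Variables (n : nat) (A : 'M[R]_(1 + n)) (lam : R) (mu : 'I_(1 + n) -> R[i]).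
Hypothesis onesA : const_mx 1 *m A = lam *: (const_mx 1 : 'rV_(1 + n)).
Hypothesis lam_gt0 : 0 < lam.
Hypothesis mu0 : mu ord0 = toC lam.
Hypothesis eigA : eigenvalues_of A mu.

Let P : 'M[R]_(1 + n) := 2^-1 *: (1%:M + lam^-1 *: A).

Let al i : R[i] := (1 + mu i * (toC lam)^-1) / 2.

Lemma char_poly_quot_map :
  char_poly (map_mx toC (quot_end A)) = \prod_(i | i != ord0) ('X - (mu i)%:P).
Proof.
have onesAC : const_mx 1 *m map_mx toC A = toC lam *: (const_mx 1 : 'rV_(1 + n)).
  have -> : const_mx 1 = map_mx toC (const_mx 1) :> 'rV_(1 + n).
    by rewrite map_const_mx rmorph1.
  by rewrite -map_mxM onesA map_mxZ.
have := eigA; rewrite /eigenvalues_of (char_poly_quot onesAC) (bigD1 ord0) //=.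
rewrite mu0 => /(mulfI (negbT (polyXsubC_eq0 _))) <-.
by rewrite map_quot_end.
Qed.

(** Each factor is [(2 * lam)^-1] times the corresponding factor for [A], so Cayley-Hamilton for the
    quotient of [A] suffices. *)
Lemma quot_end_prod_eq0 :
  \prod_(i | i != ord0) (map_mx toC (quot_end P) - (al i)%:M) = 0.
Proof.
set A' := map_mx toC (quot_end A); set P' := map_mx toC (quot_end P).
have P'E i : P' - (al i)%:M = (2 * toC lam)^-1 *: (A' - (mu i)%:M).
  have lam0 : toC lam != 0 by rewrite fmorph_eq0 gt_eqF.
  rewrite /P' /P quot_endZ quot_endD quot_end1 quot_endZ !(map_mxZ, map_mxD).
  rewrite -/A' map_mx1 !fmorphV rmorph_nat.
  apply/matrixP => a b; rewrite !mxE /al.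
  by case: (a == b); rewrite /= ?mulr1n ?mulr0n; field; exact: lam0.
rewrite (eq_bigr _ (fun i _ => P'E i)); apply: prod_roots_char_poly.
exact: char_poly_quot_map.
Qed.

Lemma quot_power_bound (rho : R) :
  (forall i, i != ord0 -> normc (al i) < rho) -> 0 < rho ->
  exists2 C, 0 <= C & forall k i j, `|(quot_end P ^+ k) i j| <= C * rho ^+ k.
Proof.
move=> al_rho rho0.
have prod0 := quot_end_prod_eq0.
pose s := [seq al i | i <- index_enum 'I_(1 + n) & i != ord0].
have H (ij : 'I_n * 'I_n) : exists D : R, 0 <= D /\
    forall k, `|(quot_end P ^+ k) ij.1 ij.2| <= D * rho ^+ k.
  have [|||D D0 HD] :=
    @power_bound _ _ (map_mx toC (quot_end P)) s rho _ _ 1 _ ij.1 ij.2 => //.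
  - by move=> _ /mapP[i +] ->; rewrite mem_filter => /andP[/al_rho].
  - by rewrite mul1r big_map big_filter.
  exists D; split=> // k; have := HD k.
  by rewrite mul1r -rmorphXn/= mxE normc_real.
have [D HD] := choice H.
(* The sum of the constants of all entries serves every entry at once. *)
exists (\sum_ij D ij) => [|k i j]; first by apply: sumr_ge0 => ij _; case: (HD ij).
apply: le_trans (proj2 (HD (i, j)) k) _.
rewrite ler_wpM2r ?exprn_ge0 ?(ltW rho0)//.
by rewrite (bigD1 (i, j))//= lerDl sumr_ge0// => ij _; case: (HD ij).
Qed.

End QuotientGrowth.

(** * First-order approximation at the origin in the sup-norm *)

Section Tangent.
Context {R : realType}.

Lemma mx_norm_entry m n (A : 'M[R]_(m, n)) i j : `|A i j| <= `|A|.
Proof.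
rewrite -[X in _ <= X]/(mx_norm A) mx_normrE.
exact: (le_bigmax _ (fun ij : 'I_m * 'I_n => `|A ij.1 ij.2|) (i, j)).
Qed.

Lemma mx_norm_le m n (A : 'M[R]_(m, n)) (c : R) :
  0 <= c -> (forall i j, `|A i j| <= c) -> `|A| <= c.
Proof.
move=> c0 Ac; rewrite -[X in X <= _]/(mx_norm A) mx_normrE.
by apply/bigmax_leP; split=> // -[i j] _; exact: Ac.
Qed.

Lemma mulmx_bounded m n (A : 'M[R]_(m, n)) :
  exists2 C, 0 < C & forall h : 'rV_m, `|h *m A| <= C * `|h|.
Proof.
have mA : 0 <= m%:R * `|A| by rewrite mulr_ge0.
exists (1 + m%:R * `|A|) => [|h]; first by rewrite ltr_pwDl.
apply: mx_norm_le => [|i j]; first by rewrite mulr_ge0// addr_ge0.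
rewrite mxE; apply: (le_trans (ler_norm_sum _ _ _)).
apply: (@le_trans _ _ (\sum_(k < m) `|A| * `|h|)).
  apply: ler_sum => k _; rewrite normrM mulrC.
  by apply: ler_pM; rewrite ?normr_ge0// mx_norm_entry.
rewrite sumr_const card_ord -[leLHS]mulr_natl [leLHS]mulrA mulrDl mul1r lerDr.
exact: normr_ge0.
Qed.

(** Differentiability at 0 with derivative [L] acting on the right; taking [h = 0] shows that it
    includes [F 0 = 0]. *)
Definition tangent0 m n (F : 'rV[R]_m -> 'rV[R]_n) (L : 'M[R]_(m, n)) : Prop :=
  forall e, 0 < e -> exists2 d, 0 < d &
    forall h, `|h| <= d -> `|F h - h *m L| <= e * `|h|.

Lemma tangent0_linear m n (L : 'M[R]_(m, n)) : tangent0 (fun h => h *m L) L.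
Proof. by move=> e e0; exists 1 => // h _; rewrite subrr normr0 mulr_ge0// ltW. Qed.

Lemma tangent0_comp m n p (F : 'rV[R]_m -> 'rV[R]_n) (G : 'rV[R]_n -> 'rV[R]_p) L M :
  tangent0 F L -> tangent0 G M -> tangent0 (G \o F) (L *m M).
Proof.
move=> FL GM e e0.
have [CL CL0 HL] := mulmx_bounded L; have [CM CM0 HM] := mulmx_bounded M.
have e1 : 0 < e / 2 / CM by rewrite !divr_gt0.
have e2 : 0 < e / 2 / (1 + CL) by rewrite !divr_gt0// ltr_pwDl// ltW.
have [d1 d10 Fd] := FL 1 ltr01.
have [d2 d20 Fd2] := FL _ e1.
have [d3 d30 Gd] := GM _ e2.
exists (Num.min (Num.min d1 d2) (d3 / (1 + CL))).
  by rewrite !lt_min d10 d20 divr_gt0// ltr_pwDl// ltW.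
move=> h; rewrite !le_min => /andP[/andP[hd1 hd2] hd3].
have Fh : `|F h| <= (1 + CL) * `|h|.
  rewrite -(subrK (h *m L) (F h)) mulrDl; apply: (le_trans (ler_normD _ _)).
  by apply: lerD; [exact: Fd | exact: HL].
have {}Gd : `|G (F h) - F h *m M| <= e / 2 * `|h|.
  apply: le_trans (Gd _ _) _.
    by apply: (le_trans Fh); rewrite mulrC -ler_pdivlMr// ltr_pwDl// ltW.
  rewrite -[leRHS]mulr1; apply: le_trans (ler_wpM2l (ltW e2) Fh) _.
  by rewrite mulrA divfK ?mulr1// gt_eqF// ltr_pwDl// ltW.
have FM : `|(F h - h *m L) *m M| <= e / 2 * `|h|.
  apply: le_trans (HM _) _; rewrite -ler_pdivlMl//.
  by apply: le_trans (Fd2 _ hd2) _; rewrite [leRHS]mulrA [_^-1 * _]mulrC.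
have -> : (G \o F) h - h *m (L *m M) =
    (G (F h) - F h *m M) + (F h - h *m L) *m M.
  by rewrite mulmxBl mulmxA addrA subrK.
apply: (le_trans (ler_normD _ _)); apply: le_trans (lerD Gd FM) _.
by rewrite -mulrDl -splitr.
Qed.

Lemma tangent0_ext m n (F G : 'rV[R]_m -> 'rV[R]_n) L :
  F =1 G -> tangent0 F L -> tangent0 G L.
Proof.
by move=> FG FL e /FL[d d0 H]; exists d => // h /H; rewrite FG.
Qed.

Lemma tangent0_map n (phi : R -> R) :
  phi 0 = 0 -> is_derive (0 : R) 1 phi 1 ->
  tangent0 (fun h : 'rV_n => map_mx phi h) 1%:M.
Proof.
move=> phi0 phi1 e e0.
have phid : derivable phi 0 1 by exact: ex_derive.
have := derivable_nbhs phid; rewrite derive_val => /eqaddoP/(_ _ e0).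
move=> /nbhs_normP[d /= d0 Hd].
(* Halving passes from the open ball of the filter to the closed one of [tangent0]. *)
exists (d / 2) => [|h hd]; first by rewrite divr_gt0.
apply: mx_norm_le; first by rewrite mulr_ge0// ltW.
move=> i j; rewrite mulmx1 !mxE.
have hij := mx_norm_entry h i j.
have hijd : `|h i j| < d.
  by apply: (le_lt_trans hij); apply: (le_lt_trans hd); rewrite ltr_pdivrMr// ltr_pMr// ltr1n.
have := Hd (h i j); rewrite /ball_ /= sub0r normrN => /(_ hijd) H.
have {H} : `|phi (h i j * 1 + 0) - (phi 0 + h i j * 1)| <= e * `|h i j| := H.
rewrite phi0 add0r addr0 mulr1 => H; apply: le_trans H _.
by rewrite ler_wpM2l// ltW.
Qed.

Lemma tangent0_differentiable m n (F : 'rV[R]_m -> 'rV[R]_n) (a : 'rV_m) :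
  differentiable F a -> tangent0 (fun h => F (a + h) - F a) (jacobian F a).
Proof.
move=> Fa e e0; have := diff_locally Fa => /eqaddoP/(_ _ e0)/nbhs_normP[d /= d0 Hd].
exists (d / 2) => [|h hd]; first by rewrite divr_gt0.
have hd' : `|h| < d.
  by apply: (le_lt_trans hd); rewrite ltr_pdivrMr// ltr_pMr// ltr1n.
have := Hd h; rewrite /ball_ /= sub0r normrN => /(_ hd') H.
have {H} : `|F (h + a) - (F a + 'd F a h)| <= e * `|h| := H.
have -> : h *m jacobian F a = 'd F a h by exact: mul_rV_lin1.
by rewrite opprD addrA [h + a]addrC.
Qed.

End Tangent.

(** * Monotone maps commuting with constants, and their oscillation *)

Section Topical.
Context {R : realType} {n : nat}.
Implicit Types (x y z : 'rV[R]_(1 + n)) (g : 'rV[R]_(1 + n) -> 'rV[R]_(1 + n)).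

Definition topical g : Prop :=
  (forall x y, le_entrywise x y -> le_entrywise (g x) (g y)) /\
  (forall x (c : R), g (x + const_mx c) = g x + const_mx c).

(** The bound [max x - min x <= d], stated without forming the extrema. *)
Definition osc_le x (d : R) : Prop := forall i j, x 0 i - x 0 j <= d.

Lemma osc_leW x d d' : d <= d' -> osc_le x d -> osc_le x d'.
Proof. by move=> dd' xd i j; apply: le_trans dd'. Qed.

Lemma osc_leD x y d d' : osc_le x d -> osc_le y d' -> osc_le (x + y) (d + d').
Proof. by move=> xd yd i j; have := xd i j; have := yd i j; rewrite !mxE; lra. Qed.

Lemma osc_le_norm x d : `|x| <= d -> osc_le x (2 * d).
Proof.
move=> xd i j; have := mx_norm_entry x 0 i; have := mx_norm_entry x 0 j.
have := ler_norm (x 0 i); have := ler_norm (- x 0 j); rewrite normrN; lra.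
Qed.

Lemma osc_leZ (a : R) x d : 0 <= a -> osc_le x d -> osc_le (a *: x) (a * d).
Proof. by move=> a0 xd i j; rewrite !mxE -mulrBr ler_wpM2l. Qed.

Lemma osc_le_quot x d :
  (forall i, `|(x *m quot_mx n) 0 i| <= d) -> 0 <= d -> osc_le x (2 * d).
Proof.
move=> xd d0.
have H k : `|x 0 k - x 0 0| <= d.
  have [j ->|j ->] := split_ordP k.
    by rewrite (_ : lshift n j = 0) ?subrr ?normr0//; apply/val_inj; rewrite (ord1 j).
  by rewrite -quot_mxE.
move=> i j; have := ler_norm (x 0 i - x 0 0); have := ler_norm (- (x 0 j - x 0 0)).
by rewrite normrN; have := H i; have := H j; lra.
Qed.

Lemma osc_le_translate x (c d : R) : osc_le (x + const_mx c) d <-> osc_le x d.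
Proof.
by split=> xd i j; have := xd i j; rewrite !mxE; lra.
Qed.

(** With [c] the least entry of [x - y], one has [y + c <= x <= y + c + d] entrywise, and [g]
    preserves this sandwich. *)
Lemma osc_le_nonexpansive g x y d :
  topical g -> osc_le (x - y) d -> osc_le (g x - g y) d.
Proof.
move=> [mono hom] xyd i j.
have [k _ kmin] := arg_minP (fun k => (x - y) 0 k) (erefl : predT (0 : 'I_(1 + n))).
have := mono (y + const_mx ((x - y) 0 k)) x.
have := mono x (y + const_mx ((x - y) 0 k + d)).
rewrite !hom /le_entrywise => /(_ _ i) H1 /(_ _ j) H2.
have {}H1 : g x 0 i <= (g y + const_mx ((x - y) 0 k + d)) 0 i.
  by apply: H1 => l; have := xyd l k; rewrite !mxE; lra.
have {}H2 : (g y + const_mx ((x - y) 0 k)) 0 j <= g x 0 j.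
  by apply: H2 => l; have := kmin l isT; rewrite !mxE; lra.
by move: H1 H2; rewrite !mxE; lra.
Qed.

Lemma topical_iter g m : topical g -> topical (iter m g).
Proof.
move=> [mono hom]; elim: m => [|m [monom homm]]; first by split.
by split=> [x y /monom/mono|x c] //=; rewrite homm hom.
Qed.

(** On the line of constant vectors [g] is the identity, so its derivative fixes that direction. *)
Lemma topical_ones g L :
  topical g -> g 0 = 0 -> tangent0 g L -> const_mx 1 *m L = const_mx 1 :> 'rV_(1 + n).
Proof.
move=> [_ hom] g0 gL; apply/eqP; rewrite eq_sym -subr_eq0 -normr_le0.
apply/ler_addgt0Pl => e e0; rewrite addr0.
have [d d0 H] := gL e e0; have := H (d *: const_mx 1).
have -> : g (d *: const_mx 1) = d *: const_mx 1.
  have -> : d *: const_mx 1 = 0 + const_mx d :> 'rV[R]_(1 + n).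
    by apply/matrixP => i j; rewrite !mxE mulr1 add0r.
  by rewrite hom g0.
have ones1 : `|const_mx 1 : 'rV[R]_(1 + n)| <= 1.
  by apply: mx_norm_le => // i j; rewrite mxE normr1.
rewrite -scalemxAl -scalerBr !normrZ (gtr0_norm d0) => {}H.
have dones : d * `|const_mx 1 : 'rV[R]_(1 + n)| <= d by rewrite ger_pMr.
rewrite -(ler_pM2l d0); apply: (le_trans (H dones)); rewrite mulrCA ler_pM2l//.
by rewrite ger_pMr.
Qed.

Lemma tangent0_iter g (P : 'M[R]_(1 + n)) m : tangent0 g P -> tangent0 (iter m g) (P ^+ m).
Proof.
move=> gP; elim: m => [|m IH].
  apply: tangent0_ext (tangent0_linear _) => h.
  by rewrite expr0 -[1]/(1%:M) mulmx1.
rewrite exprSr; apply: tangent0_ext (tangent0_comp IH gP) => h //.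
Qed.

Lemma eventually_geometric_le (a z e : R) :
  0 <= z -> z < 1 -> 0 < e -> exists N, forall k, (N <= k)%N -> a * z ^+ k <= e.
Proof.
move=> z0 z1 e0.
have := @cvg_geometric R a z; rewrite ger0_norm// => /(_ z1) /cvgr0_norm_le.
move=> /(_ e e0) [N _ HN]; exists N => k Nk.
by apply: le_trans (HN k Nk); rewrite /geometric /= ler_norm.
Qed.

(** The iterate is its linear part, small on the quotient for large [m], plus a remainder that is
    small near 0; each contributes half of the final bound. *)
Lemma local_contraction g (P : 'M[R]_(1 + n)) (P' : 'M[R]_n) (C rho1 rho : R) :
  topical g -> tangent0 g P -> P *m quot_mx n = quot_mx n *m P' ->
  0 <= C -> (forall k i j, `|(P' ^+ k) i j| <= C * rho1 ^+ k) ->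
  0 < rho1 -> rho1 < rho ->
  exists m, exists2 r, 0 < r & forall x d, 0 <= d -> d <= r ->
    osc_le x d -> osc_le (iter m.+1 g x) (rho ^+ m.+1 * d).
Proof.
move=> gtop gP PQ C0 P'C rho10 rho1rho.
have rho0 : 0 < rho := lt_trans rho10 rho1rho.
(* The threshold is a quarter because there are two contributions and each is doubled when an
   entrywise bound is turned into an oscillation. *)
have [|||m Hm] := @eventually_geometric_le (n%:R * C) (rho1 / rho) 4^-1.
- by rewrite divr_ge0// ltW.
- by rewrite ltr_pdivrMr// mul1r.
- by rewrite invr_gt0.
have {}Hm : n%:R * (C * rho1 ^+ m.+1) <= rho ^+ m.+1 / 4.
  have := Hm m.+1 (leqnSn m).
  rewrite expr_div_n [X in X <= _ -> _]mulrA ler_pdivrMr ?exprn_gt0//.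
  by rewrite mulrA [4^-1 * _]mulrC.
have rm0 : 0 < rho ^+ m.+1 by rewrite exprn_gt0.
have e0 : 0 < rho ^+ m.+1 / 4 by rewrite divr_gt0.
have [r r0 Hr] := tangent0_iter m.+1 gP e0.
exists m; exists r => // x d d0 dr xd.
(* Removing the first entry changes no oscillation and brings the sup-norm below [d], so that the
   tangent estimate applies. *)
pose y := x - const_mx (x 0 0).
have -> : x = y + const_mx (x 0 0) by rewrite subrK.
rewrite (proj2 (topical_iter m.+1 gtop)); apply/osc_le_translate.
have yE i : y 0 i = x 0 i - x 0 0 by rewrite !mxE.
have yd : `|y| <= d.
  apply: mx_norm_le => // i j; rewrite (ord1 i) yE ler_norml.
  by have := xd 0 j; have := xd j 0; lra.
rewrite -(subrK (y *m P ^+ m.+1) (iter m.+1 g y)).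
have -> : rho ^+ m.+1 * d = 2 * (rho ^+ m.+1 / 4 * d) + 2 * (rho ^+ m.+1 / 4 * d).
  by field.
apply: osc_leD.
  apply: osc_le_norm; apply: le_trans (Hr _ (le_trans yd dr)) _.
  by rewrite ler_wpM2l// ltW.
apply: osc_le_quot; last by rewrite mulr_ge0// ltW.
have PmQ : P ^+ m.+1 *m quot_mx n = quot_mx n *m P' ^+ m.+1.
  elim: (m.+1) => [|k IH]; first by rewrite !expr0 -[1]/(1%:M) mul1mx mulmx1.
  by rewrite !exprSr -[P ^+ k * P]/(_ *m _) -mulmxA PQ mulmxA IH -mulmxA.
move=> i; rewrite -mulmxA PmQ mulmxA mxE; apply: (le_trans (ler_norm_sum _ _ _)).
apply: (@le_trans _ _ (\sum_(k < n) d * (C * rho1 ^+ m.+1))).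
  apply: ler_sum => k _; rewrite normrM; apply: ler_pM; rewrite ?normr_ge0// quot_mxE.
  rewrite !yE subrr subr0 ler_norml.
  by have := xd 0 (rshift 1 k); have := xd (rshift 1 k) 0; lra.
rewrite sumr_const card_ord -[leLHS]mulr_natl [leLHS]mulrCA [leRHS]mulrC.
by rewrite ler_wpM2l.
Qed.

(* Nonexpansiveness on the part of the segment [0, x] outside the ball of
   radius [r] turns the local contraction into a fixed decrease of the
   oscillation, so the orbit enters the ball. *)
Lemma iter_osc_le g (c r : R) x :
  topical g -> c < 1 -> 0 < r ->
  (forall z, osc_le z r -> osc_le (g z) (c * r)) ->
  exists k, osc_le (iter k g x) r.
Proof.
move=> gtop c1 r0 gr.
(* Here [w] is the point of the segment from 0 to [z] at oscillation [r]: [g z - g w] has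
   oscillation at most [d - r], and [g w] at most [c * r]. *)
have step d z : r < d -> osc_le z d -> osc_le (g z) (d - (1 - c) * r).
  move=> rd zd; have d0 : 0 < d := lt_trans r0 rd.
  pose w := (r / d) *: z.
  have wr : osc_le w r.
    have := @osc_leZ (r / d) z d; rewrite divfK ?gt_eqF//; apply=> //.
    by rewrite divr_ge0// ltW.
  have zwd : osc_le (z - w) (d - r).
    have := @osc_leZ (1 - r / d) z d; rewrite mulrBl divfK ?gt_eqF// mul1r.
    rewrite scalerBl scale1r; apply=> //.
    by rewrite subr_ge0 ler_pdivrMr// mul1r ltW.
  rewrite -(subrK (g w) (g z)).
  apply: osc_leW (osc_leD (osc_le_nonexpansive gtop zwd) (gr _ wr)).
  by lra.
have cr : 0 < (1 - c) * r by rewrite mulr_gt0// subr_gt0.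
(* [N] decreases by [(1 - c) * r] bring the initial bound below [r]; the induction is on [N]. *)
have [N HN] : exists N : nat, 2 * `|x| <= r + N%:R * ((1 - c) * r).
  exists (Num.bound (2 * `|x| / ((1 - c) * r))).
  apply: ler_wpDl; first exact: ltW.
  rewrite -ler_pdivrMr//; apply: ltW; apply: archi_boundP.
  by apply: divr_ge0; [exact: mulr_ge0 | exact: ltW].
have := osc_le_norm (lexx `|x|).
move: (2 * `|x|) HN => d; elim: N x d => [|N IH] x d HN xd.
  by exists 0%N; apply: osc_leW xd; move: HN; rewrite mul0r addr0.
have [dr|rd] := leP d r; first by exists 0%N; apply: osc_leW xd.
have [||k Hk] := IH (g x) (d - (1 - c) * r).
- by move: HN; rewrite -natr1 mulrDl mul1r; lra.
- exact: step.
by exists k.+1; rewrite iterSr.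
Qed.

(** After entering the ball, the orbit stays there by nonexpansiveness, and each block of [m.+1]
    steps gains [rho ^+ m.+1]. The factor [r / rho ^+ m.+1] covers an incomplete block. *)
Lemma iter_osc_geometric g (m : nat) (r rho : R) x :
  topical g -> g 0 = 0 -> 0 < rho -> rho < 1 -> 0 < r ->
  (forall z d, 0 <= d -> d <= r -> osc_le z d ->
     osc_le (iter m.+1 g z) (rho ^+ m.+1 * d)) ->
  exists K, exists D, forall k, (K <= k)%N -> osc_le (iter k g x) (D * rho ^+ k).
Proof.
move=> gtop g0 rho0 rho1 r0 gm.
have [|||k0 Hk0] := @iter_osc_le (iter m.+1 g) (rho ^+ m.+1) r x _ _ r0.
- exact: topical_iter.
- by rewrite exprn_ilt1// ltW.
- by move=> z; apply: gm => //; exact: ltW.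
pose K := (k0 * m.+1)%N.
have HK k : osc_le (iter (K + k) g x) r.
  elim: k => [|k IH]; first by rewrite addn0 /K iterM.
  rewrite addnS iterS -[g _]subr0 -g0; apply: osc_le_nonexpansive => //.
  by rewrite subr0.
have H k : osc_le (iter (K + k) g x) (r / rho ^+ m.+1 * rho ^+ k).
  elim/ltn_ind: k => k IH; have [km|mk] := ltnP k m.+1.
    apply: osc_leW (HK k); rewrite -mulrA -[leLHS]mulr1 ler_pM2l// mulrC.
    rewrite ler_pdivlMr ?exprn_gt0// mul1r ler_wiXn2l ?(ltW rho0) ?(ltW rho1)//.
    exact: ltnW.
  (* The minimum with [r] keeps the argument within the range of the contraction even when the
     geometric bound exceeds [r]. *)
  have := @gm (iter (K + (k - m.+1)) g x) (Num.min r (r / rho ^+ m.+1 * rho ^+ (k - m.+1))).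
  rewrite -iterD addnCA subnKC// => /(_ _ _ _) H.
  apply: (@osc_leW _ (rho ^+ m.+1 * Num.min r (r / rho ^+ m.+1 * rho ^+ (k - m.+1)))).
    rewrite -[in leRHS](subnKC mk) exprD [leRHS]mulrCA ler_pM2l ?exprn_gt0//.
    by rewrite ge_min lexx orbT.
  apply: H.
  - by rewrite le_min (ltW r0)/= mulr_ge0// ?divr_ge0 ?exprn_ge0 ?ltW.
  - by rewrite ge_min lexx.
  - move=> i j; rewrite le_min HK IH//.
    by rewrite ltn_subrL/=; exact: leq_ltn_trans mk.
exists K; exists (r / rho ^+ m.+1 / rho ^+ K) => k Kk.
have := H (k - K)%N; rewrite subnKC//; apply: osc_leW.
rewrite -[in leRHS](subnKC Kk) exprD [leRHS]mulrA divfK//.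
by rewrite expf_neq0// gt_eqF.
Qed.

(** A slightly larger rate absorbs the constant [D], which makes the later [k]-th root exact. *)
Lemma iter_osc_pow g (m : nat) (r rho rho' : R) x :
  topical g -> g 0 = 0 -> 0 < rho -> rho < rho' -> rho < 1 -> 0 < r ->
  (forall z d, 0 <= d -> d <= r -> osc_le z d ->
     osc_le (iter m.+1 g z) (rho ^+ m.+1 * d)) ->
  exists K, forall k, (K <= k)%N -> osc_le (iter k g x) (rho' ^+ k).
Proof.
move=> gtop g0 rho0 rho_lt rho1 r0 gm.
have rho'0 := lt_trans rho0 rho_lt.
have [K [D HD]] := iter_osc_geometric x gtop g0 rho0 rho1 r0 gm.
have [||N HN] := @eventually_geometric_le D (rho / rho') 1 _ _ ltr01.
- by rewrite divr_ge0 ?(ltW rho0)//; exact: ltW rho'0.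
- by rewrite ltr_pdivrMr// mul1r.
exists (maxn K N) => k; rewrite geq_max => /andP[Kk Nk].
apply: osc_leW (HD k Kk); have := HN k Nk.
by rewrite expr_div_n mulrA ler_pdivrMr ?exprn_gt0// mul1r.
Qed.

End Topical.

(** * The iteration in logarithmic coordinates centred at the eigenvector *)

Section LogCoordinates.
Context {R : realType} {n : nat}.
Variables (f : 'rV[R]_(1 + n) -> 'rV[R]_(1 + n)) (u : 'rV[R]_(1 + n)) (lam : R).
Hypotheses (f_mono : monotone_on_cone f) (f_homog : homogeneous_on_cone f).
Hypotheses (u_pos : positive_vec u) (lam_gt0 : 0 < lam) (f_u : f u = lam *: u).
Implicit Types (x y h : 'rV[R]_(1 + n)).

Definition exp_vec h : 'rV[R]_(1 + n) := \row_i (u 0 i * expR (h 0 i)).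

Definition log_vec x : 'rV[R]_(1 + n) := \row_i (ln (x 0 i) - ln (u 0 i)).

Definition log_map h : 'rV[R]_(1 + n) :=
  \row_i ln (f (exp_vec h) 0 i / (lam * u 0 i)).

(** The iteration step without the normalization by the geometric mean, which only adds a constant
    vector. *)
Definition log_KM h : 'rV[R]_(1 + n) := 2^-1 *: (h + log_map h).

Lemma lam_u_gt0 i : 0 < lam * u 0 i.
Proof. by rewrite mulr_gt0. Qed.

Lemma exp_vec_pos h : positive_vec (exp_vec h).
Proof. by move=> i; rewrite mxE mulr_gt0// expR_gt0. Qed.

Lemma positive_in_cone x : positive_vec x -> in_cone x.
Proof. by move=> xpos i; exact: ltW. Qed.

Lemma log_vecK x : positive_vec x -> exp_vec (log_vec x) = x.
Proof.
move=> xpos; apply/rowP => i; rewrite !mxE expRB !lnK ?posrE//.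
by rewrite mulrC divfK// gt_eqF.
Qed.

(** A positive [x] dominates some [c *: u] with [c > 0], hence [f x] dominates [(c * lam) *: u]. *)
Lemma f_pos x : positive_vec x -> positive_vec (f x).
Proof.
move=> xpos i; rewrite -(log_vecK xpos).
move: (log_vec x) => h; pose c := expR (- `|h|).
have c0 : 0 < c by exact: expR_gt0.
have cu : le_entrywise (c *: u) (exp_vec h).
  move=> j; rewrite !mxE mulrC ler_pM2l// ler_expR.
  by have := mx_norm_entry h 0 j; have := ler_norm (- h 0 j); rewrite normrN; lra.
have upos := positive_in_cone u_pos.
have cucone : in_cone (c *: u) by move=> j; rewrite mxE mulr_ge0// ltW.
apply: lt_le_trans (f_mono cucone (positive_in_cone (exp_vec_pos h)) cu i).
by rewrite f_homog// f_u !mxE !mulr_gt0.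
Qed.

Lemma log_map_topical : topical log_map.
Proof.
split=> [x y xy i|x c].
  have fx := f_pos (exp_vec_pos x); have fy := f_pos (exp_vec_pos y).
  rewrite !mxE ler_ln ?posrE ?divr_gt0 ?lam_u_gt0//.
  rewrite ler_pM2r ?invr_gt0 ?lam_u_gt0//.
  apply: f_mono; try exact/positive_in_cone/exp_vec_pos.
  by move=> j; rewrite !mxE ler_pM2l// ler_expR.
apply/rowP => i; rewrite !mxE.
have -> : exp_vec (x + const_mx c) = expR c *: exp_vec x.
  by apply/rowP => j; rewrite !mxE expRD mulrA mulrC.
rewrite f_homog ?expR_gt0//; last exact/positive_in_cone/exp_vec_pos.
rewrite mxE -mulrA lnM ?posrE ?expR_gt0// ?expRK 1?addrC//.
by rewrite divr_gt0 ?lam_u_gt0//; exact/f_pos/exp_vec_pos.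
Qed.

Lemma log_KM_topical : topical log_KM.
Proof.
have [mono hom] := log_map_topical; split=> [x y xy i|x c].
  by have := mono _ _ xy i; have := xy i; rewrite /log_KM !mxE; lra.
by rewrite /log_KM hom; apply/rowP => i; rewrite !mxE; field.
Qed.

Lemma log_map0 : log_map 0 = 0.
Proof.
have e0 : exp_vec 0 = u by apply/rowP => i; rewrite !mxE expR0 mulr1.
by apply/rowP => i; rewrite !mxE e0 f_u mxE divff ?ln1// gt_eqF// lam_u_gt0.
Qed.

Lemma log_KM0 : log_KM 0 = 0.
Proof. by rewrite /log_KM log_map0 addr0 scaler0. Qed.

Let D : 'rV[R]_(1 + n) := \row_i (lam * u 0 i)^-1.

(* The derivative of [lam *: log_map] at the origin. *)
Definition log_jacobian : 'M[R]_(1 + n) :=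
  lam *: (diag_mx u *m jacobian f u *m diag_mx D).

Lemma is_derive_expm1 : is_derive (0 : R) 1 (fun t => expR t - 1) 1.
Proof.
have := is_deriveB (is_derive_expR (0 : R)) (is_derive_cst (1 : R) (0 : R) 1).
by rewrite expR0 subr0.
Qed.

Lemma is_derive_ln1p : is_derive (0 : R) 1 (fun s => ln (1 + s)) 1.
Proof.
have H1 : is_derive (0 : R) 1 (fun s : R => 1 + s) 1.
  have := is_deriveD (is_derive_cst (1 : R) (0 : R) 1) (is_derive_id (0 : R) 1).
  by rewrite add0r.
have H2 : is_derive (1 + 0 : R) 1 (@ln R) 1.
  by apply: is_derive_eq (is_derive1_ln _) _; rewrite ?addr0 ?invr1.
by have := is_derive1_comp H2 H1; rewrite mulr1.
Qed.

(** [log_map] is a chain of maps vanishing at 0: entrywise [expR t - 1], scaling by [u], the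
    increment of [f] at [u], division by [f u], entrywise [ln (1 + s)]. The first and last have
    identity derivative. *)
Lemma log_map_tangent : differentiable f u -> tangent0 log_map (lam^-1 *: log_jacobian).
Proof.
move=> f_diff; rewrite /log_jacobian scalerA mulVf ?gt_eqF// scale1r.
have E1 : tangent0 (fun h : 'rV[R]_(1 + n) => map_mx (fun t => expR t - 1) h) 1%:M.
  by apply: tangent0_map is_derive_expm1; rewrite expR0 subrr.
have E2 : tangent0 (fun h : 'rV[R]_(1 + n) => map_mx (fun s => ln (1 + s)) h) 1%:M.
  by apply: tangent0_map is_derive_ln1p; rewrite addr0 ln1.
have := tangent0_comp E1 (tangent0_linear (diag_mx u)); rewrite mul1mx => H.
have {}H := tangent0_comp H (tangent0_differentiable f_diff).
have {}H := tangent0_comp H (tangent0_linear (diag_mx D)).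
have {}H := tangent0_comp H E2; rewrite mulmx1 in H.
apply: tangent0_ext H => h; apply/rowP => i.
rewrite /= mul_mx_diag !mxE; congr (ln _).
have -> : u + map_mx (fun t : R => expR t - 1) h *m diag_mx u = exp_vec h.
  apply/rowP => j; rewrite mul_mx_diag !mxE. ring.
rewrite f_u mxE mulrBl divff ?gt_eqF ?lam_u_gt0//; ring.
Qed.

Lemma log_KM_tangent : differentiable f u ->
  tangent0 log_KM (2^-1 *: (1%:M + lam^-1 *: log_jacobian)).
Proof.
move=> /log_map_tangent H e e0.
have [d d0 Hd] := H (2 * e) (mulr_gt0 (ltr0Sn _ 1) e0); exists d => // h /Hd {}Hd.
rewrite /log_KM -scalemxAr -scalerBr mulmxDr mulmx1 opprD addrACA subrr add0r.
rewrite normrZ ger0_norm ?invr_ge0// ler_pdivrMl// mulrA. exact: Hd.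
Qed.

(** This is Euler's identity for [f] at [u], read off from the commutation of [log_map] with
    constants. *)
Lemma log_jacobian_ones : differentiable f u ->
  const_mx 1 *m log_jacobian = lam *: (const_mx 1 : 'rV_(1 + n)).
Proof.
move=> /log_map_tangent/(topical_ones log_map_topical log_map0) ones.
rewrite -[in RHS]ones -[X in _ = _ *: X]scalemxAr scalerA divff ?gt_eqF//.
by rewrite scale1r.
Qed.

(** [diag_mx D] is the inverse of [diag_mx u] up to [lam^-1], so [log_jacobian] is conjugate to the
    Jacobian of [f]. *)
Lemma log_jacobian_eigenvalues mu :
  eigenvalues_of (jacobian f u) mu -> eigenvalues_of log_jacobian mu.
Proof.
rewrite /eigenvalues_of => <-; rewrite -!map_char_poly; congr map_poly.
apply/esym/(@char_poly_similar _ _ (diag_mx u)).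
  by rewrite unitmxE det_diag unitfE prodf_seq_neq0; apply/allP => i _; rewrite gt_eqF.
rewrite /log_jacobian -scalemxAl -(mulmxA _ (diag_mx D)).
have -> : diag_mx D *m diag_mx u = lam^-1%:M.
  apply/matrixP => i j; rewrite mul_diag_mx !mxE.
  case: eqP => [->|]; rewrite ?mulr0n ?mulr0// !mulr1n.
  by rewrite invfM mulrAC mulfK// gt_eqF.
by rewrite mul_mx_scalar scalerA divff ?gt_eqF// scale1r.
Qed.

Lemma log_proj_KM_step x : positive_vec x ->
  positive_vec (proj_KM_step f x) /\ 
  forall i, ln (proj_KM_step f x 0 i) =
    2^-1 * (ln (f x 0 i) - ln (geo_mean (f x)) + ln (x 0 i)).
Proof.
move=> xpos; have fx := f_pos xpos.
have G0 : 0 < geo_mean (f x) by rewrite powR_gt0// prodr_gt0.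
have H i : 0 < f x 0 i / geo_mean (f x) by rewrite divr_gt0.
split=> i; first by rewrite mxE sqrtr_gt0 mulr_gt0.
rewrite mxE -powR12_sqrt; last by rewrite ltW// mulr_gt0.
by rewrite ln_powR lnM ?posrE// ln_div ?posrE.
Qed.

Lemma log_vec_step x : positive_vec x ->
  exists c, log_vec (proj_KM_step f x) = log_KM (log_vec x) + const_mx c.
Proof.
move=> xpos; have [_ H] := log_proj_KM_step xpos; have fx := f_pos xpos.
exists (2^-1 * (ln lam - ln (geo_mean (f x)))); apply/rowP => i.
rewrite /log_KM /log_map log_vecK// [LHS]mxE H !mxE ln_div ?posrE ?lam_u_gt0//.
by rewrite lnM ?posrE//; field.
Qed.

Lemma ln_prod x : positive_vec x -> ln (\prod_i x 0 i) = \sum_i ln (x 0 i).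
Proof.
move=> xpos; rewrite -[RHS]expRK expR_sum; congr ln.
by apply: eq_bigr => i _; rewrite lnK// posrE.
Qed.

(** Dividing by the geometric mean subtracts from the logarithms of [f x] their average. *)
Lemma sum_ln_step x : positive_vec x -> \sum_i ln (x 0 i) = 0 ->
  \sum_i ln (proj_KM_step f x 0 i) = 0.
Proof.
move=> xpos x0; have [_ H] := log_proj_KM_step xpos; have fx := f_pos xpos.
rewrite (eq_bigr _ (fun i _ => H i)) -mulr_sumr !big_split/= x0 addr0.
rewrite sumr_const card_ord /geo_mean ln_powR ln_prod// mulNrn.
by rewrite -[X in _ - X]mulr_natl mulrA divff ?pnatr_eq0// mul1r subrr mulr0.
Qed.

End LogCoordinates.

(** * From oscillation to Thompson's metric, and the convergence rate *)

Lemma osc_le_norm_sum0 (R : realType) n (x : 'rV[R]_(1 + n)) (d : R) :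
  0 <= d -> \sum_i x 0 i = 0 -> osc_le x d -> `|x| <= d.
Proof.
move=> d0 x0 xd; apply: mx_norm_le => // i j; rewrite (ord1 i) ler_norml.
have N0 : 0 < (1 + n)%:R :> R by rewrite ltr0n.
have E (y : R) : \sum_(k < 1 + n) y = (1 + n)%:R * y.
  by rewrite sumr_const card_ord mulr_natl.
(* For a zero-sum vector, averaging [x 0 j - x 0 k] over [k] returns [x 0 j]. *)
apply/andP; split.
  have : \sum_k (x 0 k - x 0 j) <= \sum_(k < 1 + n) d by apply: ler_sum => k _.
  by rewrite sumrB x0 !E sub0r -mulrN ler_pM2l// lerNl.
have : \sum_k (x 0 j - x 0 k) <= \sum_(k < 1 + n) d by apply: ler_sum => k _.
by rewrite sumrB x0 !E subr0 ler_pM2l.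
Qed.

Lemma limn_esup_le (R : realType) (a : nat -> \bar R) (l : \bar R) N :
  (forall k, (N <= k)%N -> (a k <= l)%E) -> (limn_esup a <= l)%E.
Proof.
move=> al; apply: ge_ereal_inf.
exists (ereal_sup [set a k | k in [set k | (N <= k)%N]])%classic.
  by exists [set k | (N <= k)%N]%classic => //; exact: nbhs_infty_ge.
by apply: ge_ereal_sup => _ [k Nk <-]; exact: al.
Qed.

Theorem theorem17 (R : realType) (n : nat)
  (f : 'rV[R]_n.+1 -> 'rV[R]_n.+1) (u : 'rV[R]_n.+1) (lambda : R)
  (mu : 'I_n.+1 -> R[i]) (v : nat -> 'rV[R]_n.+1)
  (f_cone : cone_map f)
  (f_mono : monotone_on_cone f)
  (f_homog : homogeneous_on_cone f)
  (u_pos : positive_vec u)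
  (lambda_gt0 : 0 < lambda)
  (f_u : f u = lambda *: u)
  (u_prod : \prod_i u 0 i = 1)
  (f_diff : differentiable f u)
  (mu_eig : eigenvalues_of (jacobian f u) mu)
  (mu_0 : mu ord0 = real_complex R lambda)
  (theta_lt1 : vartheta lambda mu < 1)
  (v0_pos : positive_vec (v 0%N))
  (v0_prod : \prod_i v 0%N 0 i = 1)
  (v_rec : forall k : nat, v k.+1 = proj_KM_step f (v k)) :
  (limn_esup (fun k : nat => ((thompson (v k) u) `^ (k%:R)^-1)%:E)
    <= (vartheta lambda mu)%:E)%E.
Proof.
set th := vartheta lambda mu in theta_lt1 *.
have th0 : 0 <= th by exact: bigmax_ge_id.
have v_pos k : positive_vec (v k).
  elim: k => // k /(log_proj_KM_step f_mono f_homog u_pos lambda_gt0 f_u)[] + _.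
  by rewrite v_rec.
have v_sum k : \sum_i ln (v k 0 i) = 0.
  elim: k => [|k IH]; first by rewrite -ln_prod// v0_prod ln1.
  by rewrite v_rec; exact: (sum_ln_step f_mono f_homog u_pos lambda_gt0 f_u).
pose x0 : 'rV[R]_(1 + n) := log_vec u (v 0%N).
pose g := log_KM f u lambda.
have gtop : topical g by exact: log_KM_topical.
(* The normalizing constants pass through [g] and accumulate in [c]. *)
have v_iter k : exists c, log_vec u (v k) = iter k g x0 + const_mx c.
  elim: k => [|k [c IH]]; first by exists 0; apply/rowP => i; rewrite !mxE addr0.
  have [c' Hc'] := log_vec_step f_mono f_homog u_pos lambda_gt0 f_u (v_pos k).
  exists (c + c'); rewrite v_rec Hc' IH -/g (proj2 gtop) -addrA.
  by congr (_ + _); apply/rowP => i; rewrite !mxE.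
have thompsonE k : thompson (v k) u = `|log_vec u (v k)|.
  by rewrite /thompson; congr (`|_|); apply/rowP => i; rewrite !mxE.
apply/lee_addgt0Pr => e e0; rewrite -EFinD.
(* Three rates above [th] and at most [th + e]: [r1] bounds the powers of the quotient matrix,
   [r2 < 1] is the contraction rate of an iterate, and [r3] absorbs the constant. *)
pose r1 := th + Num.min e (1 - th) / 3.
pose r2 := th + Num.min e (1 - th) / 3 * 2.
pose r3 := th + Num.min e (1 - th).
have m0 : 0 < Num.min e (1 - th) by rewrite lt_min e0 subr_gt0.
have me : Num.min e (1 - th) <= e by rewrite ge_min lexx.
have m1 : Num.min e (1 - th) <= 1 - th by rewrite ge_min lexx orbT.
have r10 : 0 < r1 by rewrite /r1; lra.
have r12 : r1 < r2 by rewrite /r1 /r2; lra.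
have r23 : r2 < r3 by rewrite /r2 /r3; lra.
have r21 : r2 < 1 by rewrite /r2; lra.
have ones := log_jacobian_ones f_mono f_homog u_pos lambda_gt0 f_u f_diff.
have [|C C0 HC] := quot_power_bound ones lambda_gt0 mu_0
  (log_jacobian_eigenvalues u_pos lambda_gt0 mu_eig) (rho := r1) _ r10.
  move=> i i0; rewrite ComplexField.Normc.normcM ComplexField.Normc.normcV.
  have -> : ComplexField.Normc.normc (2 : R[i]) = 2.
    by rewrite -[2 in LHS](rmorph_nat (real_complex R)) normc_real ger0_norm.
  apply: le_lt_trans (_ : th < r1); last by rewrite /r1; lra.
  exact: (le_bigmax_cond _ (fun i => ComplexField.Normc.normc (1 + _) / 2)).
have onesP : const_mx 1 *m (2^-1 *: (1%:M + lambda^-1 *: log_jacobian f u lambda)) =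
    1 *: const_mx 1 :> 'rV[R]_(1 + n).
  rewrite scale1r; apply: (topical_ones gtop).
    exact: log_KM0.
  exact: log_KM_tangent.
have [m [r r0 Hr]] := local_contraction gtop
  (log_KM_tangent u_pos lambda_gt0 f_u f_diff) (quot_endP onesP) C0 HC r10 r12.
have g0 : g 0 = 0 by exact: log_KM0.
have [K HK] := iter_osc_pow x0 gtop g0 (lt_trans r10 r12) r23 r21 r0 Hr.
(* Starting at [K.+1] excludes [k = 0], for which the exponent [k%:R^-1] is 0. *)
apply: (@limn_esup_le _ _ _ K.+1) => k Kk; rewrite lee_fin thompsonE.
apply: (@le_trans _ _ r3); last by rewrite /r3; lra.
have r30 : 0 <= r3 by rewrite /r3; lra.
have k0 : k%:R != 0 :> R by rewrite pnatr_eq0 -lt0n (leq_ltn_trans _ Kk).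
(* Both [v k] and [u] have product 1, so the logarithmic vector has zero sum, and the unknown
   constant [c] does not affect its oscillation. *)
have vk : `|log_vec u (v k)| <= r3 ^+ k.
  apply: osc_le_norm_sum0; first exact: exprn_ge0.
    under eq_bigr do rewrite mxE.
    by rewrite sumrB v_sum -ln_prod// u_prod ln1 subr0.
  have [c ->] := v_iter k.
  by apply/osc_le_translate/HK/ltnW.
have -> : r3 = (r3 ^+ k) `^ k%:R^-1 by rewrite -powR_mulrn// -powRrM divff// powRr1.
by apply: ge0_ler_powR; rewrite ?nnegrE ?invr_ge0 ?exprn_ge0.
Qed.
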